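(* Every Hausdorff shift-continuous hereditarily Baire topology $\tau$ on the semigroup $\mathbf{ID}_{\infty}$ is discrete.
   Context: A partial cofinite isometry of the set of integers $\mathbb{Z}$ is a partial map $\alpha\colon\mathbb{Z}\rightharpoonup\mathbb{Z}$ such that $\mathbb{Z}\setminus\operatorname{dom}\alpha$ and $\mathbb{Z}\setminus\operatorname{ran}\alpha$ are finite and $|(x)\alpha-(y)\alpha|=|x-y|$ for all $x,y\in\operatorname{dom}\alpha$. $\mathbf{ID}_{\infty}$ is the semigroup (an inverse monoid) of all partial cofinite isometries of $\mathbb{Z}$ under composition of partial maps (maps written on the right). A topology $\tau$ on a semigroup $S$ is shift-continuous if the semigroup operation is separately continuous, i.e. all left translations $x\mapsto sx$ and all right translations $x\mapsto xs$ ($s\in S$) are continuous on $(S,\tau)$. A space $X$ is Baire if for each sequence $A_1,A_2,\ldots$ of nowhere dense subsets of $X$ the set $X\setminus\bigcup_{i}A_i$ is dense in $X$; $X$ is hereditarily Baire if every nonempty closed subset of $X$ is a Baire space. *)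

(* Defs.v *)
From HB Require Import structures.
From mathcomp Require Import all_boot all_order all_algebra.
From mathcomp Require Import all_classical.
From mathcomp Require Import topology.

Set Implicit Arguments.
Unset Strict Implicit.
Unset Printing Implicit Defensive.

Import Order.TTheory GRing.Theory Num.Theory.

Local Open Scope classical_set_scope.

Record topology_on (T : Type) := TopologyOn {
  topology_open : set_system T;
  topology_openT : topology_open setT;
  topology_openI : setI_closed topology_open;
  topology_open_bigU : forall (I : Type) (f : I -> set T),
    (forall i, topology_open (f i)) -> topology_open (\bigcup_i f i)
}.

(* An alias of [T], so that several topologies can be put on a fixed [T]. *)
Definition topologized (T : Type) (tau : topology_on T) : Type := T.

HB.instance Definition _ (T : choiceType) (tau : topology_on T) :=
  Choice.copy (topologized tau) T.
HB.instance Definition _ (T : choiceType) (tau : topology_on T) :=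
  isOpenTopological.Build (topologized tau)
    (topology_openT tau) (topology_openI (t := tau))
    (topology_open_bigU (t := tau)).

Lemma open_topologized (T : choiceType) (tau : topology_on T) (A : set T) :
  open (A : set (topologized tau)) = topology_open tau A.
Proof. by []. Qed.

Definition discrete_space (X : topologicalType) := forall A : set X, open A.

Definition nowhere_dense (X : topologicalType) (A : set X) :=
  interior (closure A) = set0.

Definition Baire_space (X : topologicalType) :=
  forall A : nat -> set X, (forall n, nowhere_dense (A n)) ->
    dense (~` \bigcup_n A n).

(* [set_type A] carries the subspace topology inherited from [X]. *)
Definition hereditarily_Baire (X : topologicalType) :=
  forall A : set X, A !=set0 -> closed A -> Baire_space (set_type A).

Definition shift_continuous (S : semigroupType) (tau : topology_on S) :=
  forall s : S,
    continuous ((fun x => (s * x)%g) : topologized tau -> topologized tau) /\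
    continuous ((fun x => (x * s)%g) : topologized tau -> topologized tau).

(* A partial map from int to int is a function [f : int -> option int], with
   [f x = None] when [x] is outside the domain of [f]. *)
Definition pdom (f : int -> option int) : set int :=
  [set x | exists y, f x = Some y].

Definition pran (f : int -> option int) : set int :=
  [set y | exists x, f x = Some y].

Definition cofinite_isometry (f : int -> option int) : Prop :=
  [/\ cofinite_set (pdom f), cofinite_set (pran f) &
      forall x y u v : int, f x = Some u -> f y = Some v ->
        (`|u - v| = `|x - y|)%R].

Record ID_infty := IDInfty {
  pmap_of :> int -> option int;
  pmap_ofP : cofinite_isometry pmap_of
}.

Lemma ID_infty_inj (a b : ID_infty) : pmap_of a =1 pmap_of b -> a = b.
Proof.
case: a b => [f fP] [g gP] /= /funext fg; case: _ / fg in gP *.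
by rewrite (Prop_irrelevance fP gP).
Qed.

HB.instance Definition _ := gen_eqMixin ID_infty.
HB.instance Definition _ := gen_choiceMixin ID_infty.

Lemma cofinite_isometry_inj (f : int -> option int) (x y u : int) :
  cofinite_isometry f -> f x = Some u -> f y = Some u -> x = y.
Proof.
case=> _ _ fI fx fy; have := fI _ _ _ _ fx fy.
by rewrite subrr normr0 => /esym/normr0_eq0/eqP; rewrite subr_eq0 => /eqP.
Qed.

Lemma cofinite_isometry_comp (f g : int -> option int) :
  cofinite_isometry f -> cofinite_isometry g -> cofinite_isometry (pcomp g f).
Proof.
move=> fP gP; have [fd fr fI] := fP; have [gd gr gI] := gP.
have pcompE x v : pcomp g f x = Some v -> exists2 u, f x = Some u & g u = Some v.
  by rewrite /pcomp; case: (f x) => //= u gu; exists u.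
split.
- pose h (u : int) : int := xget (0%R : int) [set x | f x = Some u].
  apply: (@sub_finite_set _ _ (~` pdom f `|` h @` (~` pdom g))).
    move=> x /= xfg; have [[u fx]|] := pselect (pdom f x); last by left.
    right; exists u; last first.
      by rewrite /h; case: xgetP => [y _ fy|/(_ x)//];
        apply: cofinite_isometry_inj fP fy fx.
    by move=> [v gu]; apply: xfg; exists v; rewrite /pcomp fx.
  by rewrite finite_setU; split => //; exact: finite_image.
- pose h (u : int) : int := odflt 0%R (g u).
  apply: (@sub_finite_set _ _ (~` pran g `|` h @` (~` pran f))).
    move=> v /= vfg; have [[u gu]|] := pselect (pran g v); last by left.
    right; exists u; last by rewrite /h gu.
    by move=> [x fx]; apply: vfg; exists x; rewrite /pcomp fx.
  by rewrite finite_setU; split => //; exact: finite_image.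
- move=> x y u v /pcompE[a fx ga] /pcompE[b fy gb].
  by rewrite (gI _ _ _ _ ga gb) (fI _ _ _ _ fx fy).
Qed.

(* Maps are written on the right: x (a b) = (x a) b. *)
Definition ID_infty_mul (a b : ID_infty) : ID_infty :=
  IDInfty (cofinite_isometry_comp (pmap_ofP a) (pmap_ofP b)).

HB.instance Definition _ := hasMul.Build ID_infty ID_infty_mul.

Lemma ID_infty_mulA : associative ID_infty_mul.
Proof.
move=> a b c; apply: ID_infty_inj => x /=.
by rewrite /pcomp /=; case: (a x) => //= y; rewrite /pcomp /=.
Qed.

HB.instance Definition _ := Magma_isSemigroup.Build ID_infty ID_infty_mulA.

(* Main.v *)
Require Import Defs.
From HB Require Import structures.
From mathcomp Require Import all_boot all_order all_algebra.
From mathcomp Require Import all_classical.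
From mathcomp Require Import topology.
From mathcomp Require Import finmap zify.

(** The semigroup is countable: an element [f] is determined by the finite
complement of its domain and by the values of [f] at two points
([ID_infty_countable]).  A nonempty countable Baire T1 space has an isolated
point, since otherwise it is a countable union of nowhere dense singletons
([countable_Baire_isolated]).  This gives isolated points only somewhere, but
in every closed subspace, and the algebra carries them to a prescribed
element [f].

Let [e = f * f^-1], the identity map of [pdom f].  The right ideal
[A = {x | e * x = x}] contains [f] and is closed, because it is the set of
fixed points of a continuous map of a Hausdorff space.  So [A] has a relatively
isolated point [g], say [U] is open and meets [A] in [g] only.  The continuous
map [x |-> e * (x * (f^-1 * g))] takes its values in [A] and sends [f] to
[g]; hence the open preimage of [U] is its fibre over [g].  Each [x] in that
fibre agrees with [f] on the cofinite set [pdom g], and only finitely many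
partial isometries extend the restriction of [f] to that set
([translation_fiber_finite]).  Therefore [f] has a finite open neighbourhood,
and in a T1 space this makes [f] isolated. *)

Import Order.TTheory GRing.Theory Num.Theory.

Local Open Scope classical_set_scope.

(** * Isolated points in topological spaces *)

Lemma open_set_type {X : topologicalType} (A : set X) (B : set (set_type A)) :
  open B -> exists2 U : set X, open U & set_val @^-1` U = B.
Proof. by []. Qed.

Lemma set_type_accessible {X : topologicalType} (A : set X) :
  accessible_space X -> accessible_space (set_type A).
Proof.
move=> T1 x y xy; have [|U [oU xU yU]] := T1 (set_val x) (set_val y).
  by apply: contra xy => /eqP/val_inj->.
exists (set_val @^-1` U); split; first by exists U.
- by apply/mem_set; exact: set_mem xU.
- by apply/mem_set; exact: set_mem yU.
Qed.

(** An injection into [nat] lists the space as a sequence of fibres, each empty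
or a closed singleton; a singleton that is not open is nowhere dense. *)
Lemma countable_Baire_isolated {X : topologicalType} :
  accessible_space X -> countable [set: X] -> [set: X] !=set0 ->
  Baire_space X -> exists x : X, open [set x].
Proof.
move=> T1 /countable_injP[f finj] X0 BX; apply: contrapT => noiso.
have nd n : nowhere_dense (f @^-1` [set n]).
  apply: contrapT => /eqP/set0P[x xn]; apply: noiso; exists x.
  have [[a fa]|nofib] := pselect (exists a, f a = n); last first.
    move: xn; have -> : f @^-1` [set n] = set0.
      by rewrite -subset0 => a /= fa; apply: nofib; exists a.
    by rewrite closure0 interior0.
  have fibE : f @^-1` [set n] = [set a].
    apply/seteqP; split => [b /= fb|_ -> //].
    by apply: finj; rewrite ?in_setT // fa.
  move: xn; rewrite fibE.
  have /closure_id <- := accessible_closed_set1 T1 (x := a) => xa.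
  have xE := interior_subset xa; rewrite /= in xE; subst x.
  suff -> : [set a] = interior [set a] by exact: open_interior.
  by apply/seteqP; split => [_ ->//|]; exact: interior_subset.
have [x [_]] := BX _ nd _ X0 openT.
by apply; exists (f x).
Qed.

Lemma accessible_finite_open_isolated {X : topologicalType} (W : set X) (x : X) :
  accessible_space X -> finite_set W -> open W -> W x -> open [set x].
Proof.
move=> T1 finW oW Wx.
have -> : [set x] = W `&` ~` (W `\ x).
  apply/seteqP; split => [_ ->|y [Wy nWy]].
    by split=> // -[_]; apply.
  by apply: contrapT => yx; apply: nWy.
apply: openI => //; rewrite openC.
by apply: (accessible_finite_set_closed.1 T1); exact: finite_setD.
Qed.

Lemma closed_fixed_points {X : topologicalType} (f : X -> X) :
  hausdorff_space X -> continuous f -> closed [set x | f x = x].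
Proof.
rewrite open_hausdorff => haus cf.
rewrite -openC openE => x /= /eqP/haus[[U V]] /= [/set_mem Ufx /set_mem Vx].
move=> [oU oV /eqP UV0].
have /continuousP/(_ U oU) oF := cf.
apply: (@filterS _ _ _ (f @^-1` U `&` V)); last first.
  by apply: open_nbhs_nbhs; split=> //; exact: openI.
move=> y /= [Ufy Vy] fy; rewrite fy in Ufy.
by have : set0 y by rewrite -UV0.
Qed.

(** * Finiteness and countability of sets of partial isometries *)

Lemma int_eq_dist {p q s t : int} : p != q ->
  (`|s - p| = `|t - p| -> `|s - q| = `|t - q| -> s = t)%R.
Proof. lia. Qed.

(** A point of the line is determined by its distances to two distinct points,
here the values [u] and [v]. *)
Lemma ID_infty_eq {f g : ID_infty} {a b u v : int} : a != b ->
  f a = Some u -> f b = Some v -> g a = Some u -> g b = Some v ->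
  pdom f = pdom g -> f = g.
Proof.
move=> ab fa fb ga gb dfg; apply: ID_infty_inj => x.
have [_ _ fI] := pmap_ofP f; have [_ _ gI] := pmap_ofP g.
have uv : u != v.
  by apply: contra ab => /eqP uv; subst v;
    rewrite (cofinite_isometry_inj (pmap_ofP f) fa fb).
case fx: (pmap_of f x) => [s|]; case gx: (pmap_of g x) => [t|] //.
- congr Some; apply: (int_eq_dist uv).
    by rewrite (fI _ _ _ _ fx fa) (gI _ _ _ _ gx ga).
  by rewrite (fI _ _ _ _ fx fb) (gI _ _ _ _ gx gb).
- have : pdom f x by exists s.
  by rewrite dfg => -[t]; rewrite gx.
- have : pdom g x by exists t.
  by rewrite -dfg => -[s]; rewrite fx.
Qed.

Lemma infinite_int : infinite_set [set: int].
Proof.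
move=> fin; apply: infinite_nat.
by apply: (@finite_preimage _ _ _ Posz _ fin) => m n _ _ [].
Qed.

(** The values at these two points determine the isometry of Z of which [f] is
a restriction. *)
Lemma ID_infty_two_points (f : ID_infty) :
  exists a b u v : int, [/\ a != b, f a = Some u & f b = Some v].
Proof.
have [df _ _] := pmap_ofP f.
have idf := cofinite_set_infinite infinite_int df.
have [a da] := infinite_setN0 idf.
have [b [db /eqP ba]] : pdom f `\ a !=set0.
  by apply: infinite_setN0; apply: infinite_setD.
have [u fa] := da; have [v fb] := db.
by exists a, b, u, v; split => //; rewrite eq_sym.
Qed.

(** The code of [f] is the complement of its domain together with two points
and their images. *)
Lemma ID_infty_countable : countable [set: ID_infty].
Proof.
pose two_points (f : ID_infty) (c : (int * int) * (int * int)) :=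
  [/\ c.1.1 != c.1.2, f c.1.1 = Some c.2.1 & f c.1.2 = Some c.2.2].
have /choice[c cP] : forall f, exists c, two_points f c.
  move=> f; have [a [b [u [v fabuv]]]] := ID_infty_two_points f.
  by exists ((a, b), (u, v)).
pose code f := (~` pdom (pmap_of f), c f).
have codeI : {in [set: ID_infty] &, injective code}.
  move=> f g _ _ [/(congr1 setC)]; rewrite !setCK => dfg cfg.
  have [ab fa fb] := cP f; have [_ ga gb] := cP g; rewrite -cfg in ga gb.
  exact: ID_infty_eq ab fa fb ga gb dfg.
rewrite -(eq_countable (inj_card_eq codeI)).
apply: (@sub_countable _ _ _
  ([set F : set int | F `<=` setT /\ finite_set F] `*` setT)); last first.
  apply: countableX; first exact/countable_finite_subset/countableP.
  exact: (@countableP ((int * int) * (int * int))%type).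
apply: subset_card_le => _ [f _ <-].
by split => //; split => //; have [df _ _] := pmap_ofP f; exact: df.
Qed.

(** By [ID_infty_eq] such an [f] is determined by the complement of its domain,
which is one of the finitely many subsets of [F]. *)
Lemma ID_infty_extensions_finite {F : set int} {a b : int} (u v : int) :
  a != b -> finite_set F ->
  finite_set [set f : ID_infty |
    [/\ f a = Some u, f b = Some v & ~` pdom f `<=` F]].
Proof.
move=> ab finF; set W := [set f | _].
pose code (f : ID_infty) := fset_set (~` pdom f).
have finD (f : ID_infty) : finite_set (~` pdom f) by have [] := pmap_ofP f.
have codeI : {in W &, injective code}.
  move=> f g /set_mem[fa fb _] /set_mem[ga gb _]
    /(fset_set_inj (finD f) (finD g))/(congr1 setC); rewrite !setCK.
  exact: ID_infty_eq ab fa fb ga gb.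
suff fincode : finite_set (code @` W).
  by move: fincode; rewrite (eq_finite_set (inj_card_eq codeI)).
apply: (@sub_finite_set _ _ [set` fpowerset (fset_set F)]) => //.
move=> _ [f [_ _ fF] <-] /=.
by rewrite fpowersetE -fset_set_sub.
Qed.

(** * Inverses *)

Definition pinverse (f : int -> option int) (y : int) : option int :=
  if pselect (exists x, f x = Some y) is left h then Some (projT1 (cid h))
  else None.

Lemma pinverseP {f : int -> option int} {x y : int} : cofinite_isometry f ->
  pinverse f y = Some x <-> f x = Some y.
Proof.
move=> fP; rewrite /pinverse; case: pselect => [h|nh].
  case: cid => z /= fz; split => [[<-]//|fx].
  by rewrite (cofinite_isometry_inj fP fx fz).
by split => // fx; case: nh; exists x.
Qed.

Lemma cofinite_isometry_pinverse {f : int -> option int} :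
  cofinite_isometry f -> cofinite_isometry (pinverse f).
Proof.
move=> fP; have [fd fr fI] := fP.
have domE : pdom (pinverse f) = pran f.
  by apply/seteqP; split => y [x /(pinverseP fP) xy]; exists x.
have ranE : pran (pinverse f) = pdom f.
  by apply/seteqP; split => x [y /(pinverseP fP) xy]; exists y.
split; rewrite ?domE ?ranE // => x y u v.
by move=> /(pinverseP fP) fu /(pinverseP fP) /(fI _ _ _ _ fu) ->.
Qed.

Definition ID_infty_inv (f : ID_infty) : ID_infty :=
  IDInfty (cofinite_isometry_pinverse (pmap_ofP f)).

Lemma ID_infty_mulP {f g : ID_infty} {x z : int} :
  (f * g)%g x = Some z -> exists2 y, f x = Some y & g y = Some z.
Proof.
by rewrite /= /pcomp; case: (pmap_of f x) => [y|] //= gy; exists y.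
Qed.

Lemma ID_infty_invP {f : ID_infty} {x y : int} :
  ID_infty_inv f y = Some x <-> f x = Some y.
Proof. exact: pinverseP (pmap_ofP f). Qed.

Lemma ID_infty_mulVK (f : ID_infty) : (f * ID_infty_inv f * f = f)%g.
Proof.
apply: ID_infty_inj => x; rewrite /= /pcomp /=.
case fx: (pmap_of f x) => [y|] //=.
by rewrite ((pinverseP (pmap_ofP f)).2 fx).
Qed.

Lemma mul_inv_sub_id {f : ID_infty} {x y : int} :
  (f * ID_infty_inv f)%g x = Some y -> y = x.
Proof.
move=> /ID_infty_mulP[z fx /ID_infty_invP fy].
exact: cofinite_isometry_inj (pmap_ofP f) fy fx.
Qed.

(** If [g y] is defined then so is the value at [y] of the left-hand product,
and it equals [g y].  As [f * f^-1] fixes [y] and [g] is injective, [f^-1] must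
send [x y] back to [y], which means [x y = f y].  So all [x] in this set agree
with [f] on [pdom g]. *)
Lemma translation_fiber_finite (f g : ID_infty) :
  finite_set [set x : ID_infty |
    (f * ID_infty_inv f * (x * (ID_infty_inv f * g)) = g)%g].
Proof.
have [a [b [u [v [ab ga gb]]]]] := ID_infty_two_points g.
have agree (x : ID_infty) :
    (f * ID_infty_inv f * (x * (ID_infty_inv f * g)) = g)%g ->
    forall y, pdom g y -> exists2 z, x y = Some z & f y = Some z.
  move=> xg y [w gy]; have := gy; rewrite -{1}xg.
  move=> /ID_infty_mulP[y' /mul_inv_sub_id -> /ID_infty_mulP[z xy]].
  move=> /ID_infty_mulP[t /ID_infty_invP ft gt].
  exists z => //.
  by rewrite -ft (cofinite_isometry_inj (pmap_ofP g) gt gy).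
have [gd _ _] := pmap_ofP g.
(* The values of f at a and b are only known to exist when the set has a
   member. *)
set W := [set x | _]; have [->//|/set0P[h /agree hf]] := eqVneq W set0.
have da : pdom g a by exists u.
have db : pdom g b by exists v.
have [s _ fa] := hf a da; have [t _ fb] := hf b db.
apply: (sub_finite_set _ (ID_infty_extensions_finite s t ab gd)).
move=> x /= /agree xf; split.
- by have [s' -> <-] := xf a da.
- by have [t' -> <-] := xf b db.
- by apply: subsetC => y /xf[z xy _]; exists z.
Qed.

(** * Discreteness *)

Theorem mainTheorem4 (tau : topology_on ID_infty) :
  hausdorff_space (topologized tau) ->
  shift_continuous tau ->
  hereditarily_Baire (topologized tau) ->
  discrete_space (topologized tau).
Proof.
move=> haus shift hB.
have T1 := hausdorff_accessible haus.
suff iso (f : topologized tau) : open [set f].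
  by move=> A; rewrite -(image_id A) -bigcup_imset1; apply: bigcup_open.
pose e : ID_infty := (f * ID_infty_inv f)%g.
pose A : set (topologized tau) := [set x | (e * x)%g = x].
have Af : A f by exact: ID_infty_mulVK.
have cA : closed A by apply: closed_fixed_points => //; exact: (shift e).1.
have Bne : A !=set0 by exists f.
have Bcount : countable [set: set_type A].
  have [h hI] := countable_injP _ ID_infty_countable.
  apply/countable_injP; exists (h \o set_val) => x y _ _ /hI.
  by rewrite !in_setT => /(_ isT isT)/val_inj.
have [|g /open_set_type[U oU Ug]] :=
    countable_Baire_isolated (set_type_accessible A T1) Bcount _ (hB A Bne cA).
  by exists (SigSub (mem_set Af)).
have gA : (e * set_val g)%g = set_val g by exact: set_valP g.
(* Multiplication by d on the right sends f to e * g = g. *)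
pose d : ID_infty := (ID_infty_inv f * set_val g)%g.
pose translate (x : topologized tau) : topologized tau := (e * (x * d))%g.
have translateA x : A (translate x).
  by rewrite /A /translate /= !mulgA -/e !ID_infty_mulVK.
have fiberE : translate @^-1` U = [set x | translate x = set_val g].
  apply/seteqP; split => x /=.
    move=> Ux; pose y : set_type A := SigSub (mem_set (translateA x)).
    suff -> : g = y by [].
    by apply/esym; have : (set_val @^-1` U) y by []; rewrite Ug.
  by move=> ->; have : (set_val @^-1` U) g by rewrite Ug.
apply: (accessible_finite_open_isolated (translate @^-1` U)) => //.
- by rewrite fiberE; exact: translation_fiber_finite.
- have /continuousP/(_ U oU) := (shift e).1.
  by have /continuousP := (shift d).2; apply.
- by rewrite fiberE /= /translate /d !mulgA ID_infty_mulVK gA.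
Qed.
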